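(* Let $K$ be a field, $S=K[x_1,\dots,x_n]$ the standard graded polynomial ring, and $\mathfrak m=(x_1,\dots,x_n)$. Let $J\subset S$ be an $\mathfrak m$-primary ideal generated by forms of a single degree $d$. Let $k\ge 0$ be an integer and write $I=J+\mathfrak m^{d+k}$. For integers $m\ge 1$ and $p$ let $f_m(p)=(d+k)m-kp$, and let $$p_m=\min\{p\ge 1\mid \operatorname{reg} J^p\ge f_m(p)\}.$$ Then for every $m\ge 1$, $$\operatorname{reg} I^m=\min\{\operatorname{reg} J^{p_m},\ f_m(p_m-1)\}.$$
   Context: $\operatorname{reg}$ denotes Castelnuovo-Mumford regularity of a finitely generated graded $S$-module $M$: $\operatorname{reg} M=\max\{j+i\mid H^i_{\mathfrak m}(M)_j\ne 0\}$; for an ideal, it is the regularity of the ideal as a graded $S$-module. *)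

(* Defs.v *)
From mathcomp Require Import all_boot all_order all_algebra.
From mathcomp Require Import mpoly.
From Stdlib Require Import ClassicalEpsilon.

Set Implicit Arguments.
Unset Strict Implicit.
Unset Printing Implicit Defensive.

Import Order.TTheory GRing.Theory Num.Theory.
Local Open Scope ring_scope.

Section Ideals.
Context {K : fieldType} {n : nat}.
Local Notation S := {mpoly K[n]}.

(* Ideals are Prop-valued: membership in an arbitrary ideal of S comes with no
   boolean test. *)
Definition is_ideal (I : S -> Prop) : Prop :=
  [/\ I 0, forall f g, I f -> I g -> I (f + g) & forall f g, I g -> I (f * g)].

Definition ideal_gen (G : S -> Prop) : S -> Prop := fun f =>
  forall I : S -> Prop, is_ideal I -> (forall g, G g -> I g) -> I f.

Definition ideal_add (I J : S -> Prop) : S -> Prop := fun f =>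
  exists g h, [/\ I g, J h & f = g + h].

Definition ideal_mul (I J : S -> Prop) : S -> Prop :=
  ideal_gen (fun f => exists g h, [/\ I g, J h & f = g * h]).

Definition ideal_exp (I : S -> Prop) (p : nat) : S -> Prop :=
  iter p (ideal_mul I) (fun _ => True).

Definition irrelevant_ideal : S -> Prop :=
  ideal_gen (fun f => exists i : 'I_n, f = 'X_i).

Definition ideal_radical (I : S -> Prop) : S -> Prop := fun f =>
  exists N : nat, I (f ^+ N).

Definition primary_ideal (I : S -> Prop) : Prop :=
  [/\ is_ideal I, ~ I 1 & forall f g, I (f * g) -> I f \/ ideal_radical I g].

Definition irrelevant_primary (I : S -> Prop) : Prop :=
  primary_ideal I /\ forall f, ideal_radical I f <-> irrelevant_ideal f.

Definition generated_by_forms_of_degree (d : nat) (I : S -> Prop) : Prop :=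
  exists2 G : S -> Prop, (forall g, G g -> g \is d.-homog)
                       & (forall f, I f <-> ideal_gen G f).

End Ideals.

(* A graded S-module is presented by the family M of its graded pieces, M j
   being the set of elements of degree j, inside an ambient S-module V (which
   may be the module itself).  Its local cohomology with support in
   (x_1, ..., x_n) is the cohomology of the Cech complex on x_1, ..., x_n
     C^i = \bigoplus_(#|A| = i) M_(x_A),   x_A = \prod_(a in A) x_a.
   A cochain is a pair (t, c), standing for the family (c A / x_A ^ t)_A:
   finitely many fractions have a common exponent t. *)
Section LocalCohomology.
Context {K : fieldType} {n : nat} {V : lmodType {mpoly K[n]}}.
Local Notation S := {mpoly K[n]}.
Implicit Types (M : int -> V -> Prop) (c : {set 'I_n} -> V).

Definition mprodX (A : {set 'I_n}) : S := \prod_(a in A) 'X_a.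

(* v / x_A ^ t = w / x_A ^ u in the localization V_(x_A) *)
Definition eq_frac (A : {set 'I_n}) (v : V) (t : nat) (w : V) (u : nat) : Prop :=
  exists s : nat, mprodX A ^+ (s + u) *: v = mprodX A ^+ (s + t) *: w.

(* Since deg x_A = #|A|, the fraction c A / x_A ^ t has degree j exactly when
   c A has degree j + t * #|A|. *)
Definition cech_cochain M (i : nat) (j : int) (t : nat) c : Prop :=
  forall A : {set 'I_n}, #|A| = i -> M (j + (t * #|A|)%:Z) (c A).

(* Numerator, over the denominator x_B ^ t, of the B-component of the
   coboundary of (t, c). *)
Definition cech_diff (t : nat) c : {set 'I_n} -> V := fun B =>
  \sum_(b in B)
    ((-1) ^+ #|[set a in B | (a < b)%N]| * 'X_b ^+ t : S) *: c (B :\ b).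

Definition cech_cocycle (i : nat) (t : nat) c : Prop :=
  forall B : {set 'I_n}, #|B| = i.+1 -> eq_frac B (cech_diff t c B) t 0 0.

(* For i = 0 the only component is at A = set0, where cech_diff is an empty
   sum: the coboundaries are then zero, whatever (u, b) is. *)
Definition cech_coboundary M (i : nat) (j : int) (t : nat) c : Prop :=
  exists (u : nat) (b : {set 'I_n} -> V),
    cech_cochain M i.-1 j u b /\
    forall A : {set 'I_n}, #|A| = i -> eq_frac A (c A) t (cech_diff u b A) u.

(* H^i_m(M)_j <> 0 *)
Definition local_cohomology_neq0 M (i : nat) (j : int) : Prop :=
  exists (t : nat) (c : {set 'I_n} -> V),
    [/\ cech_cochain M i j t c, cech_cocycle i t c
      & ~ cech_coboundary M i j t c].

Definition is_max (P : int -> Prop) (r : int) : Prop :=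
  P r /\ forall s, P s -> s <= r.

(* The value is unspecified when the maximum does not exist (e.g. M = 0). *)
Definition regularity M : int :=
  epsilon (inhabits 0) (is_max (fun r =>
    exists (i : nat) (j : int), local_cohomology_neq0 M i j /\ r = j + i%:Z)).

End LocalCohomology.

Section IdealRegularity.
Context {K : fieldType} {n : nat}.
Local Notation S := {mpoly K[n]}.

Definition ideal_piece (I : S -> Prop) (j : int) (f : S^o) : Prop :=
  I f /\ match j with
         | Posz e => (f : S) \is e.-homog
         | Negz _ => f = 0
         end.

Definition reg (I : S -> Prop) : int := regularity (ideal_piece I).

End IdealRegularity.

Definition is_least (P : nat -> Prop) (p : nat) : Prop :=
  P p /\ forall q, P q -> (p <= q)%N.

Definition fm (d k m : nat) (p : int) : int := ((d + k) * m)%:Z - k%:Z * p.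

(* Main.v *)
From HB Require Import structures.
Require Import Defs.
From mathcomp Require Import all_boot all_order all_algebra.
From mathcomp Require Import mpoly zify ring.
From Stdlib Require Import Classical ClassicalEpsilon.

(* For an ideal Q containing all forms of large degree, reg Q is the least r
   with S_r contained in Q.  Let i + j > r.  The Cech complex of S is contracted
   in each multidegree with a non-negative entry, which covers all multidegrees
   of C^i(S)_j.  The fractions in C^(i-1)(S)_j so produced have numerators in Q
   after enlarging the denominators if i >= 2, and because S_j lies in Q if
   i = 1.  Hence H^i(Q)_j = 0.  Conversely a form of degree r - 1 outside Q gives
   a nonzero class in H^1, and 1 / (x_1 ... x_n) settles Q = S.

   In degree r, the ideal I^m = \sum_p J^p m^((d+k)(m-p)) is the sum of the
   (J^p)_r with p <= m and f_m(p) <= r, because J^p is generated in degree dp.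
   These J^p decrease with p, so S_r lies in I^m iff it lies in one of them, and
   reg I^m = \min_(p <= m) \max(f_m(p), reg J^p).  Here f_m decreases and
   reg J^p increases with p, and they cross at p_m. *)

Set Implicit Arguments.
Unset Strict Implicit.
Unset Printing Implicit Defensive.

Import Order.TTheory GRing.Theory Num.Theory.
Local Open Scope ring_scope.

Lemma is_least_ex (P : nat -> Prop) N : P N -> exists p, is_least P p.
Proof.
elim/ltn_ind: N => N IH PN.
have [[q ltqN Pq]|noq] := classic (exists2 q, (q < N)%N & P q).
  exact: IH ltqN Pq.
exists N; split=> // q Pq; rewrite leqNgt; apply/negP => ltqN.
by apply: noq; exists q.
Qed.

(** * Ideals and their powers *)

Section Ideals.
Context {K : fieldType} {n : nat}.
Local Notation S := {mpoly K[n]}.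
Implicit Types (I J T G H : S -> Prop) (f g h : S) (m : 'X_{1..n}).

Lemma ideal_sum I (A : Type) (r : seq A) (P : pred A) (F : A -> S) :
  is_ideal I -> (forall a, P a -> I (F a)) -> I (\sum_(a <- r | P a) F a).
Proof. by case=> I0 ID _ IF; apply: (big_ind I I0 ID). Qed.

Lemma is_ideal_gen G : is_ideal (ideal_gen G).
Proof.
split=> [I [I0 _ _] _|f g If Ig I idI GI|f g Ig I idI GI] //.
  by have [_ ID _] := idI; apply: ID; [apply: If | apply: Ig].
by have [_ _ IM] := idI; apply: IM; apply: Ig.
Qed.

Lemma sub_ideal_gen G f : G f -> ideal_gen G f.
Proof. by move=> Gf I _ GI; apply: GI. Qed.

Lemma ideal_mulP I J f g : I f -> J g -> ideal_mul I J (f * g).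
Proof. by move=> If Jg; apply: sub_ideal_gen; exists f, g. Qed.

Lemma ideal_mul_min I J T : is_ideal T ->
  (forall f g, I f -> J g -> T (f * g)) -> forall f, ideal_mul I J f -> T f.
Proof. by move=> idT IJT f; apply=> // _ [g [h [Ig Jh ->]]]; apply: IJT. Qed.

Lemma is_ideal_mul I J : is_ideal (ideal_mul I J).
Proof. exact: is_ideal_gen. Qed.

Lemma is_ideal_exp I p : is_ideal (ideal_exp I p).
Proof. by case: p => [//|p]; apply: is_ideal_mul. Qed.

Lemma is_ideal_add I J : is_ideal I -> is_ideal J -> is_ideal (ideal_add I J).
Proof.
move=> [I0 ID IM] [J0 JD JM]; split.
- by exists 0, 0; rewrite addr0.
- move=> _ _ [f1 [f2 [If Jf ->]]] [g1 [g2 [Ig Jg ->]]].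
  by exists (f1 + g1), (f2 + g2); split; [apply: ID|apply: JD|rewrite addrACA].
- move=> f _ [g1 [g2 [Ig Jg ->]]].
  by exists (f * g1), (f * g2); split; [apply: IM|apply: JM|rewrite mulrDr].
Qed.

Lemma ideal_exp_mulS I p f : ideal_exp I p.+1 f -> ideal_exp I p f.
Proof.
apply: ideal_mul_min; first exact: is_ideal_exp.
by move=> g h _; have [_ _ IM] := is_ideal_exp I p; apply: IM.
Qed.

Lemma ideal_exp_le I p q f : (p <= q)%N -> ideal_exp I q f -> ideal_exp I p f.
Proof.
move=> /subnK <-; elim: (q - p)%N => // i IH; rewrite addSn.
by move/ideal_exp_mulS.
Qed.

Lemma ideal_exp_sub I J p f :
  (forall g, I g -> J g) -> ideal_exp I p f -> ideal_exp J p f.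
Proof.
move=> IJ; elim: p f => // p IH f; apply: ideal_mul_min.
  exact: is_ideal_exp.
by move=> g h Ig Ih; apply: ideal_mulP; [apply: IJ|apply: IH].
Qed.

Lemma ideal_expD I p q f g :
  ideal_exp I p f -> ideal_exp I q g -> ideal_exp I (p + q) (f * g).
Proof.
move=> + Ig; elim: p f => [|p IH] f.
  by move=> _; have [_ _ IM] := is_ideal_exp I q; apply: IM.
have [IpD0 IpDD IpDM] := is_ideal_exp I (p.+1 + q).
(* [T] is the colon ideal of [ideal_exp I (p.+1 + q)] by [g], so it only has to be tested on
   generators of [ideal_exp I p.+1]. *)
pose T f := ideal_exp I (p.+1 + q) (f * g).
suff: forall f, ideal_exp I p.+1 f -> T f by apply.
apply: ideal_mul_min.
  split; rewrite /T ?mul0r// => x y; first by rewrite mulrDl; apply: IpDD.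
  by rewrite -mulrA; apply: IpDM.
by move=> x y Ix Iy; rewrite /T -mulrA; apply: ideal_mulP => //; apply: IH.
Qed.

Lemma ideal_exp_split I p q f :
  ideal_exp I (p + q) f -> ideal_mul (ideal_exp I p) (ideal_exp I q) f.
Proof.
elim: p f => [|p IH] f; first by rewrite -{2}[f]mul1r; apply: ideal_mulP.
apply: ideal_mul_min => [|x y Ix /IH]; first exact: is_ideal_mul.
have [M0 MD MM] := is_ideal_mul (ideal_exp I p.+1) (ideal_exp I q).
apply: (@ideal_mul_min _ _ (fun y => ideal_mul _ _ (x * y))) => [|a b Ia Ib].
  split=> [|a b|a b]; rewrite ?mulr0 ?mulrDr 1?mulrCA; [exact: M0| |exact: MM].
  exact: MD.
by rewrite mulrA; apply: ideal_mulP => //; apply: ideal_mulP.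
Qed.

Lemma ideal_exp_expM I p q f :
  ideal_exp I (p * q) f -> ideal_exp (ideal_exp I p) q f.
Proof.
elim: q f => [//|q IH] f; rewrite mulnS => /ideal_exp_split.
apply: ideal_mul_min => [|x y Ix /IH]; first exact: is_ideal_exp.
exact: ideal_mulP.
Qed.

Lemma ideal_exp_expr I f N p : I (f ^+ N) -> ideal_exp I p (f ^+ (N * p)).
Proof.
move=> IfN; elim: p => // p IH.
by rewrite mulnS exprD; apply: ideal_mulP.
Qed.

(** * Powers of the irrelevant ideal, seen through supports *)

Definition order_ge (e : nat) f := forall m, m \in msupp f -> (e <= mdeg m)%N.

Lemma is_ideal_order_ge e : is_ideal (order_ge e).
Proof.
split=> [m|f g ef eg m|f g eg m]; first by rewrite msupp0.
  by move/msuppD_le; rewrite mem_cat => /orP[]; [apply: ef | apply: eg].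
move/msuppM_le/allpairsP => [[m1 m2]] /= [_ /eg e2 ->].
by rewrite mdegD (leq_trans e2) ?leq_addl.
Qed.

Lemma order_geM d e f g :
  order_ge d f -> order_ge e g -> order_ge (d + e) (f * g).
Proof.
move=> df eg m /msuppM_le/allpairsP[[m1 m2]] /= [/df d1 /eg e2 ->].
by rewrite mdegD leq_add.
Qed.

Lemma order_ge_le d e f : (d <= e)%N -> order_ge e f -> order_ge d f.
Proof. by move=> de ef m /ef; apply: leq_trans. Qed.

Lemma order_ge_homog d f : f \is d.-homog -> order_ge d f.
Proof. by move=> /dhomogP df m /df ->. Qed.

Lemma order_ge_exp e I p f :
  (forall g, I g -> order_ge e g) -> ideal_exp I p f -> order_ge (e * p) f.
Proof.
move=> eI; elim: p f => [|p IH] f; first by rewrite muln0.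
apply: ideal_mul_min; first exact: is_ideal_order_ge.
by move=> g h Ig Ih; rewrite mulnS; apply: order_geM; auto.
Qed.

Lemma ideal_monomials I f :
  is_ideal I -> (forall m, m \in msupp f -> I 'X_[m]) -> I f.
Proof.
move=> idI If; rewrite (mpolyE f) big_seq; apply: ideal_sum => // m /If Im.
by rewrite -mul_mpolyC; have [_ _ IM] := idI; apply: IM.
Qed.

Lemma mpolyX_split m : (0 < mdeg m)%N ->
  exists i m', 'X_[m] = 'X_i * 'X_[m'] :> S /\ mdeg m = (mdeg m').+1.
Proof.
move=> m_gt0; have [i mi] : exists i, m i != 0%N.
  apply/existsP; apply: contraLR m_gt0 => /existsPn m0.
  by rewrite -leqNgt leqn0 mdegE big1 // => i _; apply/eqP/negPn.
have Um : (U_(i) <= m)%MM by rewrite lep1mP.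
exists i, (m - U_(i))%MM; rewrite -mpolyXD addmC submK //; split=> //.
by rewrite -{1}(submK Um) mdegD mdeg1 addn1.
Qed.

Lemma irrelevant_expP e f : ideal_exp irrelevant_ideal e f <-> order_ge e f.
Proof.
split=> [|ef].
  rewrite -[X in order_ge X]mul1n; apply: order_ge_exp => g; apply.
    exact: is_ideal_order_ge.
  by move=> _ [i ->] m; rewrite msuppX inE => /eqP ->; rewrite mdeg1.
apply: ideal_monomials; first exact: is_ideal_exp.
move=> m /ef {f ef}; elim: e m => // e IH m em.
have [i [m' [-> mE]]] := mpolyX_split (leq_ltn_trans (leq0n _) em).
apply: ideal_mulP; first by apply: sub_ideal_gen; exists i.
by apply: IH; rewrite mE in em.
Qed.

(** * Ideals containing all forms of some degree *)

Definition contains_degree I r := forall f, f \is r.-homog -> I f.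

(** A monomial of degree above [r] is a variable times a monomial of degree one less, so induction
    descends to degree [r]. *)
Lemma contains_degree_order_ge I r f :
  is_ideal I -> contains_degree I r -> order_ge r f -> I f.
Proof.
move=> idI Ir rf; apply: ideal_monomials => // m /rf {f rf}.
move Dm: (mdeg m) => D; elim: D m Dm => [|D IH] m Dm rD.
  by apply: Ir; rewrite dhomogX /= Dm eq_sym -leqn0.
move: rD; rewrite leq_eqVlt => /predU1P[rD|rD].
  by apply: Ir; rewrite dhomogX /= Dm rD.
have [|i [m' [-> mE]]] := @mpolyX_split m; first by rewrite Dm.
have [_ _ IM] := idI; apply: IM; apply: IH => //.
by move: Dm; rewrite mE => -[].
Qed.

Lemma contains_degree_le I r s :
  is_ideal I -> contains_degree I r -> (r <= s)%N -> contains_degree I s.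
Proof.
move=> idI Ir rs f /order_ge_homog sf.
by apply: contains_degree_order_ge Ir _ => //; apply: order_ge_le sf.
Qed.

Lemma contains_degree_pure_powers I : (0 < n)%N -> is_ideal I ->
  (forall i : 'I_n, ideal_radical I 'X_i) -> exists N, contains_degree I N.
Proof.
move=> n_gt0 idI /ClassicalEpsilon.choice [N IN].
exists (\sum_i N i)%N => f /dhomogP Nf; apply: ideal_monomials => // m /Nf Nm.
have [i Nmi] : exists i, (N i <= m i)%N.
  apply/existsP; apply: contra_eqT Nm => /existsPn Nm.
  rewrite /= mdegE neq_ltn; apply/orP; left.
  (* Termwise strict inequalities give a strict inequality of sums only if there is at least one
     term; [i0] provides it. *)
  pose i0 := Ordinal n_gt0.
  rewrite (bigD1 i0) //= [ltnRHS](bigD1 i0) //= -addSn leq_add //.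
    by rewrite ltnNge Nm.
  by apply: leq_sum => i _; rewrite ltnW // ltnNge Nm.
have Um : (U_(i) *+ N i <= m)%MM.
  by apply/mnm_lepP => j; rewrite mulmnE mnm1E; case: eqP => [<-|]; rewrite ?mul1n.
by rewrite -(submK Um) mpolyXD -mpolyXn; have [_ _ IM] := idI; apply: IM.
Qed.

(** * Ideals generated by forms of a single degree *)

Lemma ideal_gen_mul G H f g :
  ideal_gen G f -> ideal_gen H g ->
  ideal_gen (fun x => exists a b, [/\ G a, H b & x = a * b]) (f * g).
Proof.
move=> Gf Hg; set GH := (X in X (f * g)).
have [GH0 GHD GHM] : is_ideal GH by apply: is_ideal_gen.
apply: (Gf (fun x => GH (x * g))).
  split; rewrite ?mul0r// => x y; first by rewrite mulrDl; apply: GHD.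
  by rewrite -mulrA; apply: GHM.
move=> a Ga; apply: (Hg (fun x => GH (a * x))).
  split; rewrite ?mulr0// => x y; first by rewrite mulrDr; apply: GHD.
  by rewrite mulrCA; apply: GHM.
by move=> b Hb; apply: sub_ideal_gen; exists a, b.
Qed.

Lemma generated_by_forms_mul d e I J :
  generated_by_forms_of_degree d I -> generated_by_forms_of_degree e J ->
  generated_by_forms_of_degree (d + e) (ideal_mul I J).
Proof.
move=> [G dG IG] [H eH JH].
exists (fun x => exists a b, [/\ G a, H b & x = a * b]).
  by move=> _ [a [b [/dG da /eH eb ->]]]; apply: dhomogM.
move=> f; split.
  apply: ideal_mul_min; first exact: is_ideal_gen.
  by move=> g h /IG Gg /JH Hh; apply: ideal_gen_mul.
apply; first exact: is_ideal_mul.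
move=> _ [a [b [Ga Hb ->]]]; apply: ideal_mulP;
  first by apply/IG; apply: sub_ideal_gen.
by apply/JH; apply: sub_ideal_gen.
Qed.

Lemma generated_by_forms_exp d I p :
  generated_by_forms_of_degree d I ->
  generated_by_forms_of_degree (d * p) (ideal_exp I p).
Proof.
move=> dI; elim: p => [|p IH]; last first.
  by rewrite mulnS; apply: generated_by_forms_mul.
rewrite muln0; exists (eq 1) => [_ <-|f]; first exact: dhomog1.
split=> // _; have [_ _ GM] := is_ideal_gen (eq (1 : S)).
by rewrite -[f]mulr1; apply: GM; apply: sub_ideal_gen.
Qed.

Lemma generated_by_forms_order_ge d I f :
  generated_by_forms_of_degree d I -> I f -> order_ge d f.
Proof.
move=> [G dG IG] /IG; apply; first exact: is_ideal_order_ge.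
by move=> g /dG; apply: order_ge_homog.
Qed.

(** In degree [r], the ideal generated by [G] is spanned by products of a generator and a form of
    degree [r - d], so [T] need only contain these. *)
Lemma pihomog_ideal_gen d r G T f :
  (forall g, G g -> g \is d.-homog) -> is_ideal T ->
  (forall g h, (d <= r)%N -> G g -> h \is (r - d).-homog -> T (h * g)) ->
  ideal_gen G f -> T (pihomog [measure of mdeg] r f).
Proof.
move=> dG idT GT Gf; have [T0 TD TM] := idT.
(* Quantifying over all multiples of [f] makes [Q] an ideal, which taking the component of [f] alone
   would not. *)
pose Q f := forall h, T (pihomog [measure of mdeg] r (h * f)).
suff /(_ 1) : Q f by rewrite mul1r.
apply: (Gf Q) => [|g Gg h].
  split=> [h|a b Ta Tb h|a b Tb h]; first by rewrite mulr0 pihomog0.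
    by rewrite mulrDr pihomogD; apply: TD.
  by rewrite mulrA.
rewrite (mpolyE h) mulr_suml raddf_sum; apply: ideal_sum => // m _ /=.
rewrite -scalerAl linearZ /= -mul_mpolyC; apply: TM.
have mg : 'X_[m] * g \is (mdeg m + d).-homog.
  by apply: dhomogM; [rewrite dhomogX | apply: dG].
have [dmr|neq] := eqVneq (mdeg m + d)%N r; last by rewrite (pihomog_ne0 neq mg).
rewrite pihomog_dE -?dmr //; apply: GT; rewrite -?dmr ?leq_addl //.
by rewrite addnK dhomogX.
Qed.

Lemma pihomog_forms d r I f : is_ideal I ->
  generated_by_forms_of_degree d I -> I f -> I (pihomog [measure of mdeg] r f).
Proof.
move=> idI [G dG IG] /IG; apply: (pihomog_ideal_gen dG) => // g h _ Gg _.
by have [_ _ IM] := idI; apply: IM; apply/IG; apply: sub_ideal_gen.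
Qed.

(** The test form is the [r]-th power of a variable, whose order is exactly [r]. *)
Lemma contains_degree_bound d r I : (0 < n)%N ->
  (forall f, I f -> order_ge d f) -> contains_degree I r -> (d <= r)%N.
Proof.
move=> n_gt0 dI Ir; pose m : 'X_{1..n} := (U_(Ordinal n_gt0) *+ r)%MM.
have mr : mdeg m = r by rewrite mdegMn mdeg1 mul1n.
have /dI/(_ m) : I 'X_[m] by apply: Ir; rewrite dhomogX; apply/eqP.
by rewrite mr msuppX inE; apply.
Qed.

(** * Powers of I = J + m^(d+k), degree by degree *)

Section Truncation.
Context (d k : nat) (J : S -> Prop).
Hypotheses (J_ideal : is_ideal J) (J_forms : generated_by_forms_of_degree d J).
Let I := ideal_add J (ideal_exp irrelevant_ideal (d + k)%N).

Let J_order f : J f -> order_ge d f.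
Proof. exact: generated_by_forms_order_ge. Qed.

Let sub_JI f : J f -> I f.
Proof.
have [m0 _ _] := is_ideal_exp (@irrelevant_ideal K n) (d + k).
by exists f, 0; split; rewrite ?addr0.
Qed.

Let sub_mI f : order_ge (d + k) f -> I f.
Proof.
have [J0 _ _] := J_ideal.
by move=> df; exists 0, f; split; rewrite ?add0r ?irrelevant_expP.
Qed.

Lemma truncated_exp_order (m : nat) f : ideal_exp I m f -> order_ge (d * m) f.
Proof.
apply: order_ge_exp => _ [g [h [/J_order dg /irrelevant_expP dh ->]]].
have [_ + _] := is_ideal_order_ge d; apply=> //.
exact: order_ge_le (leq_addr _ _) dh.
Qed.

(** In a product of m elements of J or m^(d+k), either more than q factors come from J, or only i <=
    q do and the order is at least di + (d+k)(m-i) = (d+k)m - ki >= e. *)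
Lemma truncated_exp_sub (m q e : nat) f : (e + k * q <= (d + k) * m)%N ->
  ideal_exp I m f -> ideal_add (ideal_exp J q.+1) (order_ge e) f.
Proof.
elim: m q e f => [|m IH] q e f eq.
  have -> : e = 0 by lia.
  have [J0 _ _] := is_ideal_exp J q.+1.
  by move=> _; exists 0, f; rewrite add0r.
have idT := is_ideal_add (is_ideal_exp J q.+1) (is_ideal_order_ge e).
have [_ TD TM] := idT; have [T0 _ _] := is_ideal_exp J q.+1.
have Te g : order_ge e g -> ideal_add (ideal_exp J q.+1) (order_ge e) g.
  by move=> eg; exists 0, g; rewrite add0r.
apply: ideal_mul_min => // _ g [a [b [Ja /irrelevant_expP dkb ->]]] Img.
rewrite mulrDl; apply: TD; rewrite mulrC.
  (* A factor from J lowers [q] by one and [e] by [d]; if [e <= d] its order suffices by itself. *)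
  have [ed|/ltnW de] := leqP e d.
    by apply/TM/Te; apply: order_ge_le ed _; apply: J_order.
  have [g' [h' [Jg' eh' ->]]] : ideal_add (ideal_exp J q) (order_ge (e - d)) g.
    case Dq: q => [|q']; last by apply: IH Img; lia.
    by exists g, 0; rewrite addr0; split=> //; have [] := is_ideal_order_ge (e - d).
  exists (a * g'), (a * h'); split; first exact: ideal_mulP.
    by rewrite -(subnKC de); apply: order_geM => //; apply: J_order.
  by rewrite mulrC mulrDr.
(* A factor from m^(d+k) keeps [q] and lowers [e] by [d + k]. *)
have [ed|/ltnW de] := leqP e (d + k).
  by apply/TM/Te; apply: order_ge_le ed _.
have [|g' [h' [Jg' eh' ->]]] := IH q (e - (d + k))%N g _ Img; first by lia.
exists (b * g'), (b * h'); split.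
- by have [_ _ JM] := is_ideal_exp J q.+1; apply: JM.
- by rewrite -(subnKC de); apply: order_geM.
- by rewrite mulrC mulrDr.
Qed.

Lemma contains_degree_truncated_exp (m r : nat) : (0 < n)%N ->
  contains_degree (ideal_exp I m) r <->
  exists p, [/\ (p <= m)%N, ((d + k) * m <= r + k * p)%N
               & contains_degree (ideal_exp J p) r].
Proof.
move=> n_gt0; split=> [Imr|[p [pm rp Jr]] f rf]; last first.
  rewrite -(pihomog_dE rf).
  have [G dG JG] := generated_by_forms_exp p J_forms.
  (* The cofactor of a generator of J^p has degree r - dp >= (d+k)(m-p), hence lies in the (m-p)-th
     power of m^(d+k). *)
  apply: (pihomog_ideal_gen dG); [exact: is_ideal_exp| |exact/JG/Jr].
  move=> g h dr Gg rh; rewrite mulrC -(subnKC pm); apply: ideal_expD.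
    by apply: (ideal_exp_sub sub_JI); apply/JG; apply: sub_ideal_gen.
  apply: (@ideal_exp_sub (ideal_exp irrelevant_ideal (d + k))) => [x|].
    by move/irrelevant_expP; apply: sub_mI.
  apply: ideal_exp_expM; apply/irrelevant_expP.
  by apply: order_ge_le (order_ge_homog rh); nia.
(* This is f_m(m) <= r, so [m] is a candidate for the least p with f_m(p) <= r. *)
have dmr : (d * m <= r)%N.
  exact: contains_degree_bound (@truncated_exp_order m) Imr.
have [|[|q] [[qm rq] qmin]] := @is_least_ex
    (fun p => (p <= m)%N /\ ((d + k) * m <= r + k * p)%N) m.
- by split=> //; rewrite mulnDl leq_add2r.
- by exists 0; split.
exists q.+1; split=> // f rf.
(* Minimality of [q.+1] means f_m(q) >= r + 1. Hence I^m lies in J^(q+1) + m^(r+1), whose second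
   summand has no component in degree r. *)
have [|g [h [Jg rh fE]]] := @truncated_exp_sub m q r.+1 f _ (Imr f rf).
  rewrite addSn ltnNge; apply/negP => rq'.
  by have := qmin q (conj (ltnW qm) rq'); rewrite ltnn.
have -> : f = pihomog [measure of mdeg] r g.
  rewrite -(pihomog_dE rf) fE pihomogD [X in _ + X]pihomogE.
  rewrite big_seq_cond big_pred0 ?addr0 // => m'.
  by apply/negbTE/negP => /andP[/rh /ltn_eqF]; rewrite eq_sym => ->.
by apply: pihomog_forms (generated_by_forms_exp _ J_forms) Jg; apply: is_ideal_exp.
Qed.
End Truncation.
End Ideals.

(** * Signs of the simplicial coboundary and the cone homotopy *)

Section Simplicial.
Context {R : comNzRingType} {n : nat}.
Implicit Types (A B : {set 'I_n}) (C : {set 'I_n} -> R).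

Definition face_sign (b : 'I_n) B : R := (-1) ^+ #|[set a in B | (a < b)%N]|.

Lemma face_signE b B : face_sign b B = \prod_(a in B) (-1) ^+ (a < b)%N.
Proof.
rewrite /face_sign -sum1dep_card prodrXr big_mkcondr.
by congr (_ ^+ _); apply: eq_bigr => a _; case: ifP.
Qed.

Lemma face_sign_sqr b B : face_sign b B * face_sign b B = 1.
Proof. by rewrite -expr2 sqrr_sign. Qed.

(** The cancellation behind d^2 = 0: exactly one of [b < l] and [l < b] holds, which accounts for
    the minus sign. *)
Lemma face_sign_swap A b l : b \in A -> l \notin A ->
  face_sign b A * face_sign l (l |: A :\ b) =
  - (face_sign l (l |: A) * face_sign b (l |: A)).
Proof.
move=> bA lA; have neq : b != l by apply: contraNneq lA => <-.
have lAb : l \notin A :\ b by rewrite in_setD1 negb_and lA orbT.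
rewrite !face_signE !big_setU1 //= ltnn !(big_setD1 b bA) /= ltnn !mul1r.
have -> : (l < b)%N = ~~ (b < l)%N.
  by rewrite ltnNge leq_eqVlt (negPf (neq : (b : nat) != l)).
by case: (b < l)%N; rewrite /=; ring.
Qed.

(* When [\sum_l pi l] acts as the identity on [C A], this exhibits a cocycle
   [C] as a coboundary. *)
Lemma cone_homotopy C (pi : 'I_n -> {additive R -> R}) A :
  (forall l, l \notin A ->
     \sum_(b in l |: A) face_sign b (l |: A) * C ((l |: A) :\ b) = 0) ->
  \sum_(b in A) face_sign b A *
    (\sum_(l | l \notin A :\ b)
       face_sign l (l |: A :\ b) * pi l (C (l |: A :\ b)))
  = \sum_l pi l (C A).
Proof.
move=> cocC; rewrite [RHS](bigID (mem A)) /=.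
(* The term [l = b] gives back [A] itself, with a squared sign. *)
transitivity (\sum_(b in A) (pi b (C A) + \sum_(l | l \notin A)
    face_sign b A * face_sign l (l |: A :\ b) * pi l (C (l |: A :\ b)))).
  apply: eq_bigr => b bA; rewrite (bigD1 b) ?setD11 //= setD1K // mulrDr mulrA.
  rewrite face_sign_sqr mul1r mulr_sumr; congr (_ + _).
  apply: eq_big => [l|l _]; last by rewrite mulrA.
  by rewrite in_setD1; case: eqP => [->|]; rewrite ?bA ?andbT ?andbF.
rewrite big_split exchange_big /=; congr (_ + _); apply: eq_bigr => l lA.
(* For [l] outside [A], the cocycle condition on [l |: A] expresses [C A] through the other
   faces. *)
have /eqP := cocC l lA; rewrite big_setU1 //= setU1K // addr_eq0 => /eqP CE.
rewrite -[C A]mul1r -(face_sign_sqr l (l |: A)) -mulrA CE mulrN -mulNr.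
rewrite mulr_sumr raddf_sum; apply: eq_bigr => b bA.
rewrite face_sign_swap //.
have -> : (l |: A) :\ b = l |: A :\ b.
  apply/setP => a; rewrite !inE; case: eqP => // ->.
  by case: eqP lA => // <-; rewrite bA.
by rewrite /face_sign !mulNr raddfN -!mulrA !raddfMsign.
Qed.

End Simplicial.

(** * Monomial projections, division by monomials and integer degrees *)

Section Monomials.
Context {K : fieldType} {n : nat}.
Local Notation S := {mpoly K[n]}.
Implicit Types (P : pred 'X_{1..n}) (p q : S) (m mu : 'X_{1..n}).

Definition mproj P p : S := \sum_(m <- msupp p | P m) p@_m *: 'X_[m].

Lemma mcoeff_mproj P p m : (mproj P p)@_m = if P m then p@_m else 0.
Proof.
rewrite /mproj raddf_sum /=.
under eq_bigr do rewrite mcoeffZ mcoeffX.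
have [mp|mp] := boolP (m \in msupp p); last first.
  rewrite big_seq_cond big1 ?(memN_msupp_eq0 mp) ?if_same // => m' /andP[m'p _].
  by rewrite (_ : m' == m = false) ?mulr0 //; apply: contraNF mp => /eqP <-.
rewrite big_mkcond (bigD1_seq m) //= big1 ?eqxx ?mulr1 ?addr0 // => m' neq.
by rewrite (negPf neq) mulr0 if_same.
Qed.

Lemma msupp_mproj P p m : m \in msupp (mproj P p) -> P m && (m \in msupp p).
Proof. by rewrite !mcoeff_msupp mcoeff_mproj; case: ifP; rewrite ?eqxx. Qed.

Lemma mproj_is_additive P : {morph mproj P : p q / p - q}.
Proof.
move=> p q; apply/mpolyP => m; rewrite mcoeffB !mcoeff_mproj mcoeffB.
by case: ifP; rewrite ?subr0.
Qed.

HB.instance Definition _ P :=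
  GRing.isAdditive.Build S S (mproj P) (@mproj_is_additive P).

(** Subtraction of exponents is truncated, so this is a true quotient only under the hypothesis of
    [mquoK]. *)
Definition mquo mu p : S := \sum_(m <- msupp p) p@_m *: 'X_[m - mu].

Lemma mquoK mu p :
  {in msupp p, forall m : 'X_{1..n}, (mu <= m)%MM} -> 'X_[mu] * mquo mu p = p.
Proof.
move=> mup; rewrite [RHS]mpolyE mulr_sumr !big_seq; apply: eq_bigr => m mp.
by rewrite -scalerAr -mpolyXD addmC submK ?mup.
Qed.

Lemma msuppXM mu q m :
  m \in msupp ('X_[mu] * q) -> exists2 m', m' \in msupp q & m = (mu + m')%MM.
Proof.
rewrite mulrC (perm_mem (msuppMX _ _)) => /mapP[m' m'q ->].
by exists m'.
Qed.

Lemma mem_msuppXM mu q m :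
  m \in msupp q -> (mu + m)%MM \in msupp ('X_[mu] * q).
Proof. by move=> mq; rewrite mulrC (perm_mem (msuppMX _ _)) map_f. Qed.

Lemma mprodX_mesym1 (A : {set 'I_n}) t :
  mprodX A ^+ t = 'X_[mesym1 A *+ t] :> S.
Proof.
rewrite /mprodX -mpolyXn; congr (_ ^+ _); rewrite mpolyXE_id big_mkcond.
by apply: eq_bigr => i _; rewrite mnmE; case: (i \in A); rewrite ?expr1 ?expr0.
Qed.

Lemma mesym1_setC_D1 (B : {set 'I_n}) b : b \in B ->
  mesym1 (~: (B :\ b)) = (U_(b) + mesym1 (~: B))%MM.
Proof.
move=> bB; apply/mnmP => a; rewrite mnmDE mnm1E !mnmE !inE.
by have [->|_] := eqVneq a b; rewrite ?bB.
Qed.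

Lemma mesym1_setD1 (B : {set 'I_n}) b : b \in B ->
  mesym1 B = (U_(b) + mesym1 (B :\ b))%MM.
Proof.
move=> bB; apply/mnmP => a; rewrite mnmDE mnm1E !mnmE !inE.
by have [->|_] := eqVneq a b; rewrite ?bB.
Qed.

(** For negative [j] only zero qualifies, which removes the case split in [ideal_piece]. *)
Definition homz (j : int) p :=
  {in msupp p, forall m : 'X_{1..n}, (mdeg m)%:Z = j}.

Lemma homz_nat (e : nat) p : p \is e.-homog <-> homz e%:Z p.
Proof.
split=> [/dhomogP pe m /pe <- //|pe]; apply/dhomogP => m /pe.
by move=> /eqP; rewrite eqz_nat => /eqP.
Qed.

Lemma ideal_pieceE (Q : S -> Prop) j p : ideal_piece Q j p <-> Q p /\ homz j p.
Proof.
rewrite /ideal_piece; case: j => e.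
  by split=> -[Qp] /homz_nat.
split=> -[Qp pe]; split=> //; first by rewrite pe => m; rewrite msupp0.
apply: msuppnil0; case Dp: (msupp p) => [//|m r].
by have := pe m; rewrite Dp inE eqxx => /(_ isT).
Qed.

End Monomials.

(** * The Cech complex of S and its contraction *)

Section Cech.
Context {K : fieldType} {n : nat}.
Local Notation S := {mpoly K[n]}.
Implicit Types (c b : {set 'I_n} -> S) (A B : {set 'I_n}) (p q : S).

Lemma cech_diffE t c B :
  @cech_diff K n S^o t c B =
  \sum_(b in B) face_sign b B * ('X_b ^+ t * c (B :\ b)).
Proof. by apply: eq_bigr => b _; rewrite mulrA. Qed.

Lemma msupp_face_sign (a : 'I_n) B p : msupp (face_sign a B * p) =i msupp p.
Proof.
move=> m; rewrite /face_sign -signr_odd mulr_sign.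
by case: ifP; rewrite // (perm_mem (msuppN _)).
Qed.

Lemma mprodX_neq0 A t : mprodX A ^+ t != 0 :> S.
Proof. by rewrite mprodX_mesym1 -msupp_eq0 msuppX. Qed.

(** S is a domain, so a fraction vanishes only if its numerator does. *)
Lemma cech_cocycleE i t c : @cech_cocycle K n S^o i t c <->
  forall B, #|B| = i.+1 -> @cech_diff K n S^o t c B = 0.
Proof.
split=> cocc B Bi; last by exists 0; rewrite cocc // !scaler0.
have [s] := cocc B Bi; rewrite scaler0; apply: (contra_eq _) => dB.
by rewrite mulf_neq0 ?mprodX_neq0.
Qed.

(* Numerator of [c A / x_A ^ t] over the denominator [x_1 ^ t ... x_n ^ t],
   common to all components of the cochain [(t, c)]. *)
Definition cech_num t c A : S := 'X_[mesym1 (~: A) *+ t] * c A.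

(** Over a common denominator the Cech coboundary becomes the simplicial one of [cone_homotopy]: the
    factor ['X_b ^+ t] is absorbed by the complement of [B :\ b]. *)
Lemma cech_num_diff t c B :
  \sum_(b in B) face_sign b B * cech_num t c (B :\ b) =
  'X_[mesym1 (~: B) *+ t] * @cech_diff K n S^o t c B.
Proof.
rewrite cech_diffE mulr_sumr; apply: eq_bigr => b bB.
rewrite /cech_num mesym1_setC_D1 // -mpolyXn mpolyXD exprMn mpolyXn mpolyXn.
ring.
Qed.

Section Primitive.
Context (t : nat) (c : {set 'I_n} -> S).

(** Over the denominator (x_1 ... x_n)^t, [t <= m a] says that x_a has non-negative exponent.
    Picking one such index per monomial makes the projections add up to the identity. *)
Definition first_ge (l : 'I_n) (m : 'X_{1..n}) :=
  [pick a | (t <= m a)%N] == Some l.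

Definition cone A : S :=
  \sum_(l | l \notin A)
    face_sign l (l |: A) * mproj (first_ge l) (cech_num t c (l |: A)).

Lemma first_ge_le l m : first_ge l m -> (t <= m l)%N.
Proof. by rewrite /first_ge; case: pickP => // a ta /eqP[<-]. Qed.

Lemma sum_mproj_first_ge p :
  {in msupp p, forall m : 'X_{1..n}, exists l, (t <= m l)%N} ->
  \sum_l mproj (first_ge l) p = p.
Proof.
move=> tp; apply/mpolyP => m; rewrite raddf_sum /=.
under eq_bigr do rewrite mcoeff_mproj.
have [/tp[l tl]|mp] := boolP (m \in msupp p); last first.
  by rewrite (memN_msupp_eq0 mp) big1 // => l _; rewrite if_same.
rewrite /first_ge; case: pickP => [a _|/(_ l)]; last by rewrite tl.
rewrite (bigD1 a) //= eqxx big1 ?addr0 // => a' neq.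
by rewrite (_ : Some a == Some a' = false) //; apply/eqP => -[/esym/eqP]; apply/negP.
Qed.

(** The divisibility lets the cone be written over x_A^t alone. An index outside [A] is either the
    apex [l], with exponent at least [t] by choice, or outside [l |: A], where [cech_num] supplies
    [t]. *)
Lemma msupp_cone A m : m \in msupp (cone A) ->
  (mesym1 (~: A) *+ t <= m)%MM /\
  exists2 l, l \notin A & m \in msupp (cech_num t c (l |: A)).
Proof.
move=> /msupp_sum_le/flatten_mapP[l].
rewrite mem_filter => /andP[lA _].
rewrite msupp_face_sign => /msupp_mproj/andP[/first_ge_le tl mC].
split; last by exists l.
apply/mnm_lepP => a; rewrite mulmnE mnmE inE.
have [//|aA] := boolP (a \in A); rewrite mul1n.
have [->//|al] := eqVneq a l.
have [m' _ ->] := msuppXM mC.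
by rewrite mnmDE mulmnE mnmE !inE negb_or al aA mul1n leq_addr.
Qed.

Definition cech_primitive A := mquo (mesym1 (~: A) *+ t) (cone A).

Lemma cech_primitiveP A :
  (forall B, #|B| = #|A|.+1 -> @cech_diff K n S^o t c B = 0) ->
  {in msupp (cech_num t c A), forall m : 'X_{1..n}, exists l, (t <= m l)%N} ->
  @cech_diff K n S^o t cech_primitive A = c A.
Proof.
move=> cocc tA; have nzX : 'X_[mesym1 (~: A) *+ t] != 0 :> S.
  by rewrite -msupp_eq0 msuppX.
apply: (mulfI nzX); rewrite -cech_num_diff -/(cech_num t c A).
rewrite -[RHS]sum_mproj_first_ge //.
rewrite -(@cone_homotopy _ _ _ (fun l => mproj (first_ge l) : {additive S -> S})).
  apply: eq_bigr => b _; rewrite /cech_num mquoK // => m.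
  by case/msupp_cone.
by move=> l lA; rewrite cech_num_diff cocc ?mulr0 // cardsU1 lA add1n.
Qed.

(** The degree of the common-denominator numerator does not depend on [A], so the cone preserves
    [j]. *)
Lemma homz_cech_num A j :
  homz (j + (t * #|A|)%:Z) (c A) -> homz (j + (t * n)%:Z) (cech_num t c A).
Proof.
move=> cA m /msuppXM[m' /cA m'E ->].
have n_eq : (t * n = t * #|A| + t * #|~: A|)%N.
  by rewrite -mulnDr cardsC card_ord.
by rewrite mdegD mdegMn mdeg_mesym1 PoszD m'E n_eq; lia.
Qed.

Lemma homz_cech_primitive A j :
  (forall B, #|B| = #|A|.+1 -> homz (j + (t * #|B|)%:Z) (c B)) ->
  homz (j + (t * #|A|)%:Z) (cech_primitive A).
Proof.
move=> cj m; move/(mem_msuppXM (mesym1 (~: A) *+ t)); rewrite mquoK; last first.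
  by move=> m' /msupp_cone[].
case/msupp_cone => _ [l lA /homz_cech_num-/(_ j)].
have n_eq : (t * n = t * #|A| + t * #|~: A|)%N.
  by rewrite -mulnDr cardsC card_ord.
move=> H; have := H (cj _ _); rewrite mdegD mdegMn mdeg_mesym1 cardsU1 lA n_eq.
by lia.
Qed.

End Primitive.

(** * Local cohomology and regularity of an ideal containing all forms of large degree *)

Lemma cech_coboundary_high (Q : S -> Prop) r i j t c : (0 < n)%N ->
  is_ideal Q -> contains_degree Q r -> r%:Z < j + i%:Z ->
  cech_cochain (ideal_piece Q) i j t c -> @cech_cocycle K n S^o i t c ->
  @cech_coboundary K n S^o (ideal_piece Q) i j t c.
Proof.
move=> n_gt0 idQ Qr rij cj /cech_cocycleE cocc.
have cjh A : #|A| = i -> homz (j + (t * #|A|)%:Z) (c A).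
  by move=> /cj /ideal_pieceE[].
have [Q0 _ _] := idQ.
have primitive A : #|A| = i -> @cech_diff K n S^o t (cech_primitive t c) A = c A.
  move=> Ai; apply: cech_primitiveP => [B|m mA]; first by rewrite Ai; apply: cocc.
  have [AT|/subsetPn[l _ lA]] := boolP (setT \subset A); last first.
    exists l; have [m' _ ->] := msuppXM mA.
    by rewrite mnmDE mulmnE mnmE inE lA mul1n leq_addr.
  (* Now i = n. If all exponents were below [t], the degree j + tn would be at most tn - n,
     contradicting 0 <= r < j + n. *)
  apply/existsP; apply: contraT => /existsPn mt.
  have mn : (mdeg m + n <= t * n)%N.
    rewrite mdegE -[n in (_ + n)%N]card_ord -sum1_card -big_split /=.
    rewrite mulnC -[n in leqRHS]card_ord -sum_nat_const; apply: leq_sum => l _.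
    by rewrite addn1 ltnNge mt.
  have /(_ m mA) := homz_cech_num (cjh A Ai).
  have : i = n by rewrite -Ai (eqP (_ : A == setT)) ?cardsT ?card_ord // -subTset.
  by move=> iE mE; move: rij mn; rewrite iE; lia.
(* For i = 0 the coboundary is an empty sum, so [primitive] says that [c] vanishes at [set0]. *)
have [i0|i_gt0] := posnP i.
  exists 0%N, (fun=> 0); split=> [A _|A Ai].
    by apply/ideal_pieceE; split=> // m; rewrite msupp0.
  have A0 : A = set0 by apply/eqP; rewrite -cards_eq0 Ai i0.
  by rewrite -primitive // A0 /cech_diff !big_set0; exists 0; rewrite !scaler0.
(* Numerator and denominator are both multiplied by x_A^s; for #|A| >= 1 this lifts the numerator to
   degree at least [r]. *)
pose s := (r + `|j|)%N.
pose b A := mprodX A ^+ s * cech_primitive t c A.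
exists (t + s)%N, b; split=> [A Ai|A Ai]; last first.
  exists 0; rewrite !add0n -(primitive A Ai) exprD [LHS]/GRing.scale /= -mulrA.
  congr (_ * _); rewrite !cech_diffE mulr_sumr; apply: eq_bigr => a aA.
  rewrite /b !mprodX_mesym1 (mesym1_setD1 aA) -[LHS]/(_ * _).
  by rewrite -!mpolyXn mpolyXD exprMn exprD; ring.
have bj : homz (j + ((t + s) * #|A|)%:Z) (b A).
  move=> m; rewrite /b mprodX_mesym1 => /msuppXM[m' m'b ->].
  rewrite mdegD mdegMn mdeg_mesym1 PoszD.
  rewrite (homz_cech_primitive (j := j) _ m'b) ?Ai; last first.
    by move=> B; rewrite prednK //; apply: cjh.
  by lia.
apply/ideal_pieceE; split=> //; apply: contains_degree_order_ge Qr _ => // m /bj.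
(* For i = 1 enlarging the denominator has no effect, but the numerator has degree j, and r < j + 1
   gives r <= j. *)
move: rij; rewrite Ai /s; case: (i) i_gt0 => // -[|i'] _; last by nia.
by rewrite muln0; lia.
Qed.

(* The class of 1 / (x_1 ... x_n). *)
Lemma local_cohomology_top_neq0 (Q : S -> Prop) :
  contains_degree Q 0 -> local_cohomology_neq0 (ideal_piece Q) n (- n%:Z).
Proof.
move=> Q0; exists 1%N, (fun=> 1); split=> [A An|B Bn|[u [b [_ bP]]]].
- apply/ideal_pieceE; split; first exact/Q0/dhomog1.
  by move=> m; rewrite msupp1 inE => /eqP ->; rewrite mdeg0 An; lia.
- by have := max_card (mem B); rewrite Bn card_ord ltnn.
have [|s] := bP setT; first by rewrite cardsT card_ord.
rewrite cech_diffE -[_ *: _]/(_ * _) mulr1 -[RHS]/(_ * _) !mprodX_mesym1.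
set m : 'X_{1..n} := (_ *+ (s + u))%MM => mE.
have : m \in msupp ('X_[m] : S) by rewrite msuppX inE.
(* Each monomial on the right has exponent at least s + 1 + u in some variable, while the left one
   has s + u in all. *)
rewrite mE => /msuppXM[m' + m'E] => /msupp_sum_le/flatten_mapP[a _].
rewrite msupp_face_sign mpolyXn => /msuppXM[m'' _ m''E].
have /mnmP/(_ a) := m'E; rewrite m''E !mnmDE !mulmnE mnm1E mnmE eqxx inE.
by lia.
Qed.

(** The class is the image of g under the connecting map from H^0(S/Q) to H^1(Q). Writing g as x_a^r
    g / x_a^r puts the numerators in Q; a primitive in Q would have to equal g. *)
Lemma local_cohomology1_neq0 (Q : S -> Prop) r j g : (0 < n)%N ->
  is_ideal Q -> contains_degree Q r -> homz j g -> ~ Q g ->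
  local_cohomology_neq0 (ideal_piece Q) 1 j.
Proof.
move=> n_gt0 idQ Qr jg nQg.
exists r, (fun A => mprodX A ^+ r * g); split=> [A A1||[u [b [bQ bP]]]].
- apply/ideal_pieceE; split.
    have [_ _ QM] := idQ; rewrite mulrC; apply/QM/Qr.
    by rewrite mprodX_mesym1 dhomogX /= mdegMn mdeg_mesym1 A1 mul1n.
  move=> m; rewrite mprodX_mesym1 => /msuppXM[m' /jg m'j ->].
  by rewrite mdegD mdegMn mdeg_mesym1; lia.
- apply/cech_cocycleE => B B2; rewrite cech_diffE.
  have /cards2P[x [y [neq ->]]] : #|B| == 2%N by apply/eqP.
  have xy : x \notin [set y] by rewrite inE.
  rewrite !big_setU1 //= !big_set1 setU1K // setUC setU1K ?inE 1?eq_sym //.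
  rewrite !face_signE !big_setU1 ?inE 1?eq_sym //= !big_set1 /mprodX.
  rewrite !big_set1 !ltnn.
  have -> : (y < x)%N = ~~ (x < y)%N.
    by rewrite ltnNge leq_eqVlt (negPf (neq : (x : nat) != y)).
  by case: (x < y)%N => /=; ring.
pose a := Ordinal n_gt0.
have [|s] := bP [set a]; first by rewrite cards1.
rewrite cech_diffE big_set1 setDv face_signE big_set1 ltnn mul1r.
rewrite -[LHS]/(_ * _) -[RHS]/(_ * _) /mprodX big_set1 !mulrA -!exprD addnAC => E.
apply: nQg; have Xa_neq0 : 'X_a != 0 :> S by rewrite -msupp_eq0 msuppX.
have /ideal_pieceE[+ _] := bQ set0 (cards0 _).
by rewrite (mulfI (expf_neq0 _ Xa_neq0) E).
Qed.

Lemma local_cohomology_ideal_neq0 (Q : S -> Prop) r : (0 < n)%N ->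
  is_ideal Q -> is_least (contains_degree Q) r ->
  exists i j, local_cohomology_neq0 (ideal_piece Q) i j /\ r%:Z = j + i%:Z.
Proof.
move=> n_gt0 idQ [Qr rmin]; case: (posnP r) Qr rmin => [->|r_gt0] Qr rmin.
  exists n, (- n%:Z); split; last by rewrite addNr.
  exact: local_cohomology_top_neq0.
exists 1%N, (r%:Z - 1); split; last by rewrite subrK.
have /not_all_ex_not[g ng] : ~ contains_degree Q r.-1.
  by move/rmin; rewrite leqNgt prednK ?leqnn.
have {ng}[rg nQg] := imply_to_and _ _ ng.
apply: (local_cohomology1_neq0 n_gt0 idQ Qr _ nQg).
by move/homz_nat: rg; rewrite -subn1 -subzn.
Qed.

Lemma reg_least_degree (Q : S -> Prop) r : (0 < n)%N ->
  is_ideal Q -> is_least (contains_degree Q) r -> reg Q = r%:Z.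
Proof.
move=> n_gt0 idQ Qr; rewrite /reg /regularity.
set P := fun s => exists i j, _; set e := epsilon _ _.
have maxr : is_max P r%:Z.
  split; first exact: local_cohomology_ideal_neq0.
  move=> s [i [j [[t [c [cj cocc ncob]]] ->]]]; rewrite leNgt; apply/negP => rij.
  by apply: ncob; apply: cech_coboundary_high rij cj cocc => //; case: Qr.
(* Since a maximum exists, the epsilon choice is one, and maxima are unique. *)
have [Pe emax] : is_max P e by apply: epsilon_spec; exists r%:Z.
have [Pr rmax] := maxr.
by apply/eqP; rewrite eq_le rmax ?emax.
Qed.

End Cech.

(** * Powers of an m-primary ideal contain all forms of large degree *)

Section PrimaryPowers.
Context {K : fieldType} {n : nat}.
Local Notation S := {mpoly K[n]}.

Lemma contains_degree_exp (J : S -> Prop) p : (0 < n)%N ->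
  irrelevant_primary J -> exists N, contains_degree (ideal_exp J p) N.
Proof.
move=> n_gt0 [_ radJ]; apply: contains_degree_pure_powers => // [|i].
  exact: is_ideal_exp.
have [N JN] : ideal_radical J 'X_i.
  by apply/radJ; apply: sub_ideal_gen; exists i.
by exists (N * p)%N; apply: ideal_exp_expr.
Qed.

End PrimaryPowers.

(** * The crossing of f_m(p) and reg J^p, and the conclusion *)

Lemma least_of_max_le (rho : nat -> nat) (d k m R : nat) :
  rho 0 = 0 -> {homo rho : p q / (p <= q)%N} -> (d * m <= rho m)%N ->
  is_least (fun r => exists p,
    [/\ (p <= m)%N, ((d + k) * m <= r + k * p)%N & (rho p <= r)%N]) R ->
  (1 <= m)%N ->
  exists2 pm : nat,
    is_least (fun p => (1 <= p)%N /\ fm d k m p%:Z <= (rho p)%:Z) pm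
  & R%:Z = Num.min (rho pm)%:Z (fm d k m (pm%:Z - 1)).
Proof.
move=> rho0 rho_homo rho_m [[p [pm Rp rhoR]] Rmin] m_gt0.
have [|p1 [[pm_gt0 pm_le] pm_min]] := @is_least_ex
    (fun p => (1 <= p)%N /\ fm d k m p%:Z <= (rho p)%:Z) m.
  by split=> //; rewrite /fm; lia.
exists p1 => //; have p1m : (p1 <= m)%N.
  by apply: pm_min; split=> //; rewrite /fm; lia.
(* Below [p1] the value rho(q) is at most f_m(q). The case q = 0, excluded from the minimum defining
   [p1], follows from rho(0) = 0. *)
have rho_lt q : (q < p1)%N -> (rho q + k * q <= (d + k) * m)%N.
  case: q => [|q] qpm; first by rewrite rho0; lia.
  have [//|lt] := leqP (rho q.+1 + k * q.+1) ((d + k) * m).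
  suff : (p1 <= q.+1)%N by rewrite leqNgt qpm.
  by apply: pm_min; split=> //; rewrite /fm; lia.
have R_le1 : (R <= rho p1)%N.
  by apply: Rmin; exists p1; split=> //; move: pm_le; rewrite /fm; lia.
case: p1 pm_gt0 pm_le pm_min p1m rho_lt R_le1 => // q _ fq q_min qm rho_lt R1.
have km : (k * q <= k * m)%N by rewrite leq_mul2l ltnW ?orbT.
have kdm : (k * m <= (d + k) * m)%N by rewrite leq_mul2r leq_addl orbT.
have kq := leq_trans km kdm.
have R_le2 : (R <= (d + k) * m - k * q)%N.
  apply: Rmin; exists q; split; first exact: ltnW.
    by rewrite subnK.
  by have := rho_lt q (leqnn _); lia.
have {fq} -> : fm d k m (q.+1%:Z - 1) = ((d + k) * m - k * q)%N%:Z.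
  by rewrite /fm; lia.
(* Here [p] attains R. Beyond the crossing, monotonicity of [rho] forces R = rho(q+1); before it,
   monotonicity of f_m forces R = f_m(q). *)
have [qp|pq] := ltnP q p.
  have R_eq : R = rho q.+1.
    by apply/eqP; rewrite eqn_leq R1 (leq_trans (rho_homo _ _ qp)).
  by rewrite R_eq; rewrite R_eq in R_le2; apply/esym/min_idPl; rewrite lez_nat.
have kpq : (k * p <= k * q)%N by rewrite leq_mul2l pq orbT.
have R_eq : R = ((d + k) * m - k * q)%N by lia.
by rewrite -R_eq; apply/esym/min_idPr; rewrite lez_nat.
Qed.

Theorem theorem2p3 (K : fieldType) (n : nat) (n_gt0 : (0 < n)%N)
    (d k : nat) (J : {mpoly K[n]} -> Prop)
    (J_primary : irrelevant_primary J)
    (J_forms : generated_by_forms_of_degree d J) :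
  let I := ideal_add J (ideal_exp irrelevant_ideal (d + k)%N) in
  forall m : nat, (1 <= m)%N ->
    exists2 pm : nat,
      is_least (fun p => (1 <= p)%N /\ fm d k m p%:Z <= reg (ideal_exp J p)) pm
    & reg (ideal_exp I m)
      = Num.min (reg (ideal_exp J pm)) (fm d k m (pm%:Z - 1)).
Proof.
move=> I m m_gt0.
have J_ideal : is_ideal J by case: J_primary => -[].
have ex_rho p : exists r, is_least (contains_degree (ideal_exp J p)) r.
  by have [N] := contains_degree_exp p n_gt0 J_primary; apply: is_least_ex.
have [rho rhoP] := ClassicalEpsilon.choice _ ex_rho.
have regJ p : reg (ideal_exp J p) = (rho p)%:Z.
  by apply: reg_least_degree => //; apply: is_ideal_exp.
have rho_leP p r : contains_degree (ideal_exp J p) r <-> (rho p <= r)%N.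
  have [Jp pmin] := rhoP p; split; first exact: pmin.
  by apply: contains_degree_le Jp; apply: is_ideal_exp.
have containsI r : contains_degree (ideal_exp I m) r <-> exists p,
    [/\ (p <= m)%N, ((d + k) * m <= r + k * p)%N & (rho p <= r)%N].
  rewrite contains_degree_truncated_exp //.
  by split=> -[p [? ? /rho_leP ?]]; exists p.
have dm : (d * m <= rho m)%N.
  have [Jm _] := rhoP m; apply: contains_degree_bound Jm => // f.
  exact: generated_by_forms_order_ge (generated_by_forms_exp _ J_forms).
have [R [IR Rmin]] : exists R, is_least (contains_degree (ideal_exp I m)) R.
  (* At this degree the exponent p = m satisfies all three conditions. *)
  apply: (@is_least_ex _ (maxn ((d + k) * m) (rho m))); apply/containsI.
  by exists m; rewrite leqnn leq_maxr (leq_trans (leq_maxl _ _) (leq_addr _ _)).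
have regI : reg (ideal_exp I m) = R%:Z.
  by apply: reg_least_degree => //; apply: is_ideal_exp.
have [||||//|pm [[pm_gt0 fpm] pm_min] RE] := @least_of_max_le rho d k m R.
- by apply/eqP; rewrite -leqn0; apply/rho_leP.
- move=> p q pq; apply/rho_leP => f rf; apply: ideal_exp_le pq _.
  by have [Jq _] := rhoP q; apply: Jq.
- exact: dm.
- by split=> [|r /containsI/Rmin]; first exact/containsI.
exists pm; last by rewrite regI regJ.
split=> [|q]; rewrite regJ //; exact: pm_min.
Qed.
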